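(* Let $r$ and $s$ be positive integers with $r \geq s \geq 2$. If $r > 3s - 3$, then $f(s,r,3) = 3s + 3r - 4$.
   Context: For integers $a\le b$, $[a,b]=\{n\in\mathbb{N} : a\le n\le b\}$. For a finite set $X\subseteq\mathbb{N}$, $\mathrm{diam}(X)=\max(X)-\min(X)$. $f(s,r,3)$ denotes the smallest positive integer $n$ such that for every coloring $\Delta:[1,n]\to\{1,2,3\}$ there exist subsets $S_1,S_2\subseteq[1,n]$ with: (a) $S_1$ and $S_2$ each monochromatic (not necessarily of the same color); (b) $|S_1|=s$, $|S_2|=r$; (c) $\max(S_1)<\min(S_2)$; (d) $\mathrm{diam}(S_1)\le\mathrm{diam}(S_2)$. *)

(* Defs.v *)
From mathcomp Require Import all_boot.
From mathcomp Require Import finmap.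

Set Implicit Arguments.
Unset Strict Implicit.
Unset Printing Implicit Defensive.

Local Open Scope fset_scope.

Definition fmax (X : {fset nat}) : nat := \max_(x <- X) x.

(* Seeding the fold with [fmax X] is harmless when X is nonempty, as
   [fmax X] then belongs to X; on the empty set both extrema are 0. *)
Definition fmin (X : {fset nat}) : nat := \big[minn/fmax X]_(x <- X) x.

Definition diam (X : {fset nat}) : nat := fmax X - fmin X.

Definition monochromatic (k : nat) (Delta : nat -> 'I_k) (X : {fset nat}) : Prop :=
  exists c : 'I_k, forall x : nat, x \in X -> Delta x = c.

(* A k-coloring of [1, n] is given by a function on all of nat; its values
   outside [1, n] are irrelevant because S1 and S2 are subsets of [1, n]. *)
Definition forces (s r k n : nat) : Prop :=
  forall Delta : nat -> 'I_k,
  exists S1 S2 : {fset nat},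
    [/\ (forall x : nat, x \in S1 -> 1 <= x <= n) /\
        (forall x : nat, x \in S2 -> 1 <= x <= n),
        monochromatic Delta S1 /\ monochromatic Delta S2,
        #|` S1| = s /\ #|` S2| = r,
        fmax S1 < fmin S2
      & diam S1 <= diam S2].

(* [is_f s r k N] is the equation f(s,r,k) = N. *)
Definition is_f (s r k N : nat) : Prop :=
  [/\ 0 < N, forces s r k N
    & forall n : nat, 0 < n -> forces s r k n -> N <= n].

(* Main.v *)
Require Import Defs.
From mathcomp Require Import all_boot.
From mathcomp Require Import finmap zify.

(** Upper bound: by pigeonhole the first [3s-2] integers contain a monochromatic
    [s]-set, of diameter at most [3s-3], and the last [3r-2] integers contain a
    monochromatic [r]-set, of diameter at least [r-1 >= 3s-3].
    Lower bound: color [x] by [x mod 3]. A monochromatic [s]-set does not fit in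
    [[1, 3s-3]], so [S2] lies in [[3s-1, 3s+3r-5]], a block of [3r-3] consecutive
    integers with only [r-1] elements of each color. *)

Lemma le_fmax (X : {fset nat}) (x : nat) : x \in X -> x <= fmax X.
Proof. by move=> xX; apply: (@leq_bigmax_seq _ (enum_fset X) xpredT id). Qed.

Lemma fmax_le (X : {fset nat}) (b : nat) :
  (forall x, x \in X -> x <= b) -> fmax X <= b.
Proof. by move=> Xb; apply/bigmax_leqP_seq => x xX _; apply: Xb. Qed.

Lemma fmin_le (X : {fset nat}) (x : nat) : x \in X -> fmin X <= x.
Proof.
(* The seed of the fold depends on [X]; it is replaced by an arbitrary [z] so that the induction can
   run over the list alone. *)
rewrite /fmin => xX; move: (fmax X) => z.
have {xX} : x \in (enum_fset X) by [].
elim: (enum_fset X) => // y l IHl; rewrite inE big_cons.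
by case/orP => [/eqP -> | /IHl]; lia.
Qed.

Lemma le_fmin (X : {fset nat}) (a : nat) :
  0 < #|` X| -> (forall x, x \in X -> a <= x) -> a <= fmin X.
Proof.
rewrite cardfs_gt0 => /fset0Pn[x0 x0X] aX; rewrite /fmin big_seq.
apply: (big_ind (fun y => a <= y)); last exact: aX.
  (* The seed [fmax X] also has to be at least [a]: this is where nonemptiness enters. *)
  exact: leq_trans (aX _ x0X) (le_fmax _ _ x0X).
by move=> x y ax ay; rewrite leq_min ax ay.
Qed.

Lemma card_le_diamS (X : {fset nat}) : #|` X| <= (diam X).+1.
Proof.
have sub : {subset enum_fset X <= iota (fmin X) (diam X).+1}.
  move=> x xX; rewrite mem_iota /diam.
  by have := fmin_le _ _ xX; have := le_fmax _ _ xX; lia.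
by have := uniq_leq_size (fset_uniq X) sub; rewrite size_iota.
Qed.

Lemma diam_interval (X : {fset nat}) (a d : nat) :
  0 < #|` X| -> (forall x, x \in X -> a <= x <= a + d) -> diam X <= d.
Proof.
move=> X0 Xad; rewrite /diam.
have : fmax X <= a + d by apply: fmax_le => x /Xad/andP[].
have : a <= fmin X by apply: le_fmin => // x /Xad/andP[].
lia.
Qed.

(** If every color occurred at most [t.-1] times, summing the color classes would give
    [L <= k * t.-1]. *)
Lemma interval_pigeonhole (k : nat) (Delta : nat -> 'I_k) (a L t : nat) :
  k * t.-1 < L ->
  exists X : {fset nat},
    [/\ forall x, x \in X -> a <= x < a + L, monochromatic Delta X & #|` X| = t].
Proof.
move=> ktL.
have [c tc] : exists c, t <= count (fun x => Delta x == c) (iota a L).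
  apply/existsP; apply: contraLR ktL; rewrite negb_exists => /forallP few.
  rewrite -leqNgt -{1}(size_iota a L) -sum1_size.
  rewrite (partition_big Delta xpredT) //=.
  have -> : k * t.-1 = \sum_(c < k) t.-1 by rewrite sum_nat_const card_ord.
  apply: leq_sum => c _; rewrite sum1_count.
  have := few c; set m := count _ _; move=> few_c; apply: (@leq_trans m).
    by apply/eq_leq/eq_count.
  lia.
(* The color class may be too large, so it is cut down to exactly [t] elements. *)
pose l := take t [seq x <- iota a L | Delta x == c].
have lP x : x \in l -> (Delta x == c) && (x \in iota a L).
  by move/mem_take; rewrite mem_filter.
exists [fset x in l]%fset; split.
- by move=> x; rewrite inE => /lP/andP[_]; rewrite mem_iota.
- by exists c => x; rewrite inE => /lP/andP[/eqP].
rewrite card_fseq undup_id ?take_uniq ?filter_uniq ?iota_uniq //.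
by rewrite size_takel // size_filter.
Qed.

Definition mod_coloring (k x : nat) : 'I_k.+1 := inord (x %% k.+1).

(** Cut the interval into [t] blocks of [k.+1] consecutive integers: each block meets a residue
    class only once, so the block index [q] is injective on [X]. *)
Lemma card_mod_coloring (k : nat) (X : {fset nat}) (a t : nat) :
  monochromatic (mod_coloring k) X ->
  (forall x, x \in X -> a <= x < a + k.+1 * t) -> #|` X| <= t.
Proof.
move=> [c Xc] Xat.
have modX x : x \in X -> x %% k.+1 = c.
  by move/Xc => <-; rewrite inordK // ltn_mod.
pose q x := (x - a) %/ k.+1.
have q_inj : {in enum_fset X &, injective q}.
  move=> x y xX yX qxy.
  have /andP[ax _] := Xat _ xX; have /andP[ay _] := Xat _ yX.
  have xy : x - a = y - a %[mod k.+1].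
    by apply/eqP; rewrite -(eqn_modDr a) !subnK // !modX.
  have : x - a = y - a.
    by rewrite (divn_eq (x - a) k.+1) -/(q x) qxy xy -divn_eq.
  lia.
have sub : {subset map q (enum_fset X) <= iota 0 t}.
  move=> _ /mapP[x xX ->]; rewrite mem_iota /= ltn_divLR //.
  by have := Xat _ xX; lia.
have q_uniq : uniq (map q (enum_fset X)) by rewrite map_inj_in_uniq ?fset_uniq.
by have := uniq_leq_size q_uniq sub; rewrite size_map size_iota.
Qed.

Theorem theorem4p6 (r s : nat) (hs : 2 <= s) (hsr : s <= r)
    (hr : 3 * s - 3 < r) :
  is_f s r 3 (3 * s + 3 * r - 4).
Proof.
split; first lia.
- move=> Delta.
  have [|S1 [S1i S1m S1s]] := @interval_pigeonhole 3 Delta 1 (3 * s - 2) s.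
    lia.
  have [|S2 [S2i S2m S2r]] :=
    @interval_pigeonhole 3 Delta (3 * s - 1) (3 * r - 2) r; first lia.
  exists S1, S2; split=> //.
  + by split=> x => [/S1i | /S2i]; lia.
  + have : fmax S1 <= 3 * s - 2 by apply: fmax_le => x /S1i; lia.
    have : 3 * s - 1 <= fmin S2 by apply: le_fmin => [|x /S2i]; lia.
    lia.
  + have : diam S1 <= 3 * s - 3.
      by apply: (@diam_interval _ 1) => [|x /S1i]; lia.
    have := card_le_diamS S2; lia.
move=> n _ /(_ (mod_coloring 2)) [S1 [S2 [[S1i S2i] [S1m S2m] [S1s S2r] lt12 _]]].
rewrite leqNgt; apply/negP => n_small.
(* Either [S1] lies in the first [s.-1] blocks of three, too few for [s] elements of one color, or
   it has an element [x >= 3 * s - 2]. *)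
have [|/allPn[x xS1 x_large]] := boolP (all (fun x => x < 1 + 3 * s.-1) S1).
  move/allP=> S1small.
  have : #|` S1| <= s.-1.
    apply: (card_mod_coloring _ _ 1) S1m _ => x xS1.
    by have := S1small _ xS1; have := S1i _ xS1; lia.
  lia.
(* Here [S2] lies beyond [x], hence starts at [3 * s - 1] or later, and [n <= 3 * s + 3 * r - 5]
   leaves at most [r.-1] blocks of three. *)
have : #|` S2| <= r.-1.
  apply: (card_mod_coloring _ _ (3 * s - 1)) S2m _ => y yS2.
  have := S2i _ yS2; have := fmin_le _ _ yS2; have := le_fmax _ _ xS1; lia.
lia.
Qed.
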